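(* Let $d\geq 2$. There exist a bounded open set $\mathcal{X}\subset\mathbb{R}^d$ and a compact set $\mathcal{Y}\subset\mathbb{R}^d$ such that, if $\rho$ denotes the uniform probability measure on $\mathcal{X}$, then for every $C>0$, every real $p\geq 1$ and every $\alpha>\frac{p}{2(p+1)}$ (in particular for $\alpha=\frac12$), the inequality $$\forall \mu,\nu\in\mathcal{P}(\mathcal{Y}),\qquad \|T_\mu-T_\nu\|_{L^2(\rho)}\leq C\, W_p(\mu,\nu)^{\alpha}$$ fails (i.e. there exist $\mu,\nu\in\mathcal{P}(\mathcal{Y})$ with $\|T_\mu-T_\nu\|_{L^2(\rho)}> C\, W_p(\mu,\nu)^{\alpha}$).
   Context: The uniform probability measure on $\mathcal{X}$ is the normalized restriction of the Lebesgue measure to $\mathcal{X}$. For $\mathcal{Y}\subset\mathbb{R}^d$, $\mathcal{P}(\mathcal{Y})$ denotes the set of Borel probability measures on $\mathcal{Y}$ (viewed as probability measures on $\mathbb{R}^d$ concentrated on $\mathcal{Y}$). $\mathcal{P}_2(\mathbb{R}^d)$ is the set of probability measures on $\mathbb{R}^d$ with finite second moment. $W_p$ denotes the $p$-Wasserstein distance with respect to the Euclidean distance: $W_p(\mu,\nu)^p=\inf_\gamma\int |x-y|^p\,\mathrm{d}\gamma(x,y)$, the infimum being over couplings $\gamma$ of $\mu$ and $\nu$. Given $\rho,\mu\in\mathcal{P}_2(\mathbb{R}^d)$ with $\rho$ absolutely continuous with respect to the Lebesgue measure, $T_\mu\in L^2(\rho)=L^2(\rho;\mathbb{R}^d)$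 denotes the optimal transport map (Brenier map) from $\rho$ to $\mu$ for the quadratic cost, i.e. the $\rho$-a.e. unique minimizer of $\int |x-T(x)|^2\,\mathrm{d}\rho(x)$ among measurable maps $T:\mathbb{R}^d\to\mathbb{R}^d$ with $T_\#\rho=\mu$; its existence and $\rho$-a.e. uniqueness are given by Brenier's theorem. The norm is $\|T_\mu-T_\nu\|_{L^2(\rho)}=\left(\int |T_\mu(x)-T_\nu(x)|^2\,\mathrm{d}\rho(x)\right)^{1/2}$. *)

(* Defs.v *)
From HB Require Import structures.
From mathcomp Require Import all_boot all_order all_algebra.
From mathcomp Require Import all_classical all_reals all_analysis.

Set Implicit Arguments.
Unset Strict Implicit.
Unset Printing Implicit Defensive.
Import Order.TTheory GRing.Theory Num.Theory.
Import numFieldNormedType.Exports.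
Local Open Scope classical_set_scope.
Local Open Scope ring_scope.

HB.instance Definition _ (R : realType) (d : nat) :=
  Measurable.copy 'rV[R]_d (g_sigma_algebraType (@open 'rV[R]_d)).

Section borel_rV.
Context {R : realType}.

Lemma open_measurable_rV d (U : set 'rV[R]_d) : open U -> measurable U.
Proof. by move=> oU; apply: sub_sigma_algebra. Qed.

Lemma measurable_coord_rV d (i : 'I_d) :
  measurable_fun setT (fun x : 'rV[R]_d => x ord0 i).
Proof.
apply: (measurability _ (measurable_realfun.RGenOpens.measurableE R)).
move=> _ [_ [a [b ->] <-]]; rewrite setTI.
apply: open_measurable_rV; apply: open_comp; last exact: interval_open.
by move=> x _; exact: coord_continuous.
Qed.

Lemma open_rV_rat_balls d (U : set 'rV[R]_d) : open U ->
  U = \bigcup_(qn : 'rV[rat]_d * nat)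
    (if `[< ball (map_mx ratr qn.1 : 'rV[R]_d) (qn.2.+1%:R^-1) `<=` U >]
     then ball (map_mx ratr qn.1 : 'rV[R]_d) (qn.2.+1%:R^-1) else set0).
Proof.
move=> oU; apply/seteqP; split => [x Ux|x [[q n] _] /=]; last first.
  by case: ifPn => // /asboolP; apply.
have /nbhs_ballP[e /= e0 eU] : nbhs x U by exact: open_nbhs_nbhs.
have [n ne] : exists n, n.+1%:R^-1 < e / 2.
  have [n _ /(_ n (leqnn n))] :=
    near_infty_natSinv_lt (PosNum (divr_gt0 e0 (ltr0n _ 2))).
  by exists n.
have /choice[q qx] : forall i, exists q : rat,
    ratr q \in `]x ord0 i - n.+1%:R^-1, x ord0 i + n.+1%:R^-1[.
  move=> i; apply: rat_in_itvoo.
  by rewrite ltrD2l gtrN// invr_gt0 ltr0n.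
have qxb : ball (map_mx ratr (\row_i q i) : 'rV[R]_d) n.+1%:R^-1 x.
  split=> [|i j]; first by rewrite invr_gt0 ltr0n.
  rewrite (ord1 i) !mxE /ball/= ltr_distlC.
  by have := qx j; rewrite in_itv/= => /andP[? ?];
    apply/andP; split; [rewrite ltrBlDr|rewrite -ltrBlDr].
exists (\row_i q i, n) => //=; case: ifPn => [//|/asboolP]; case.
move=> y qy; apply: eU.
apply: (@le_ball _ _ _ (n.+1%:R^-1 + n.+1%:R^-1)).
  by rewrite [leRHS]splitr lerD// ltW.
exact: (ball_triangle (ball_sym qxb) qy).
Qed.

Lemma measurable_fun_rV d0 (T : measurableType d0) d (f : T -> 'rV[R]_d) :
  (forall i, measurable_fun setT (fun x => f x ord0 i)) ->
  measurable_fun setT f.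
Proof.
move=> mf; apply: (measurability (@open 'rV[R]_d)) => //.
move=> _ [U oU <-]; rewrite setTI (open_rV_rat_balls oU) preimage_bigcup.
apply: countable_bigcupT_measurable => [|[q n]]; first exact: countableP.
case: ifPn => // _; last by rewrite preimage_set0.
rewrite [X in measurable X](_ : _ = \bigcap_(i : 'I_d)
    ((fun x => f x ord0 i) @^-1` ball (ratr (q ord0 i) : R) n.+1%:R^-1)).
  apply: fin_bigcap_measurable => // i _; rewrite -[X in measurable X]setTI.
  apply: mf => //; apply: measurable_realfun.open_measurable.
  by apply: ball_open; rewrite invr_gt0 ltr0n.
apply/seteqP; split => [x /= xb i _|x xb] /=.
  by have := xb.2 ord0 i; rewrite mxE.
split=> [|i j]; first by rewrite invr_gt0 ltr0n.
by rewrite (ord1 i) mxE; exact: (xb j I).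
Qed.

Definition cons_rV d (xy : measurableTypeR R * 'rV[R]_d) : 'rV[R]_d.+1 :=
  row_mx (xy.1 : R)%:M xy.2.

Definition uncons_rV d (x : 'rV[R]_d.+1) : measurableTypeR R * 'rV[R]_d :=
  (x ord0 ord0, rsubmx (x : 'rV[R]_(1 + d))).

Lemma cons_rVK d : cancel (@cons_rV d) (@uncons_rV d).
Proof.
move=> [x y]; rewrite /uncons_rV /cons_rV /= row_mxKr.
congr (_, _); have -> : (ord0 : 'I_(1 + d)) = lshift d ord0 by exact: val_inj.
by rewrite (row_mxEl (x : R)%:M y) mxE eqxx mulr1n.
Qed.

Lemma measurable_cons_rV d : measurable_fun setT (@cons_rV d).
Proof.
apply: measurable_fun_rV => i.
have [k|k] := @split_ordP 1 d i => ->.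
  apply: eq_measurable_fun (@measurable_fst _ _ (measurableTypeR R) 'rV[R]_d) => x _ /=.
  by rewrite /cons_rV (row_mxEl (x.1 : R)%:M x.2) (ord1 k) mxE eqxx mulr1n.
apply: eq_measurable_fun (measurableT_comp (measurable_coord_rV k)
  (@measurable_snd _ _ (measurableTypeR R) 'rV[R]_d)) => x _ /=.
by rewrite /cons_rV (row_mxEr (x.1 : R)%:M x.2).
Qed.

Lemma measurable_uncons_rV d : measurable_fun setT (@uncons_rV d).
Proof.
apply/measurable_fun_pairP; split; first exact: measurable_coord_rV.
apply: measurable_fun_rV => i.
apply: eq_measurable_fun (measurable_coord_rV (rshift 1 i)) => x _ /=.
by rewrite mxE.
Qed.

(* Lebesgue measure on R^d: iterated product of the Lebesgue measure on R,
   transported along R x R^d -> R^(d+1). *)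
Fixpoint lebesgue_rV d : set 'rV[R]_d -> \bar R :=
  match d with
  | 0 => \d_(0 : 'rV[R]_0)
  | d'.+1 =>
    pushforward (@lebesgue_measure R \x @lebesgue_rV d')%E (@cons_rV d')
  end.

Section lebesgue_rV_step.
Variables (d : nat) (mu : {sigma_finite_measure set 'rV[R]_d -> \bar R}).

Local Definition lebesgue_step : set 'rV[R]_d.+1 -> \bar R :=
  pushforward (@lebesgue_measure R \x mu)%E (@cons_rV d).

Let m : {measure set (measurableTypeR R * 'rV[R]_d)%type -> \bar R} :=
  (@lebesgue_measure R \x mu)%E.

Let lebesgue_step0 : lebesgue_step set0 = 0%E.
Proof. exact: (measure0 m). Qed.

Let preimage_cons_measurable (A : set 'rV[R]_d.+1) :
  measurable A -> measurable (@cons_rV d @^-1` A).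
Proof.
by move=> mA; rewrite -[X in measurable X]setTI; exact: measurable_cons_rV.
Qed.

Let lebesgue_step_ge0 A : (0 <= lebesgue_step A)%E.
Proof. exact: (measure_ge0 m). Qed.

Let lebesgue_step_semi_sigma_additive : semi_sigma_additive lebesgue_step.
Proof.
move=> F mF tF mUF; rewrite /lebesgue_step /pushforward preimage_bigcup.
apply: (@measure_semi_sigma_additive _ _ _ m).
- by move=> n; exact: preimage_cons_measurable.
- apply/trivIsetP => /= i j _ _ ij; rewrite -preimage_setI.
  by move/trivIsetP : tF => /(_ _ _ _ _ ij) ->//; rewrite preimage_set0.
- by rewrite -preimage_bigcup; exact: preimage_cons_measurable.
Qed.

HB.instance Definition _ := isMeasure.Build _ _ _ lebesgue_step
  lebesgue_step0 lebesgue_step_ge0 lebesgue_step_semi_sigma_additive.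

Let lebesgue_step_sigma_finite : sigma_finite setT lebesgue_step.
Proof.
have cK k : @cons_rV d @^-1` (@uncons_rV d @^-1` k) = k.
  by apply/seteqP; split => x /=; rewrite cons_rVK.
have /sigma_finiteP[F [FT ndF mF]] := sigma_finiteT (@lebesgue_measure R).
have /sigma_finiteP[G [GT ndG mG]] := sigma_finiteT mu.
exists (fun k => @uncons_rV d @^-1` (F k `*` G k)).
  rewrite -preimage_bigcup; apply/seteqP; split => // x _ /=.
  have [n _ Fn] : (\bigcup_i F i) (uncons_rV x).1 by rewrite -FT.
  have [k _ Gk] : (\bigcup_i G i) (uncons_rV x).2 by rewrite -GT.
  exists (maxn n k) => //; split => /=.
    by move: Fn; exact/subsetPset/ndF/leq_maxl.
  by move: Gk; exact/subsetPset/ndG/leq_maxr.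
move=> k; have [mFk Fkoo] := mF k; have [mGk Gkoo] := mG k; split.
  rewrite -[X in measurable X]setTI; apply: measurable_uncons_rV => //.
  exact: measurableX.
rewrite /lebesgue_step /pushforward cK product_measure1E//.
by rewrite lte_mul_pinfty// ge0_fin_numE.
Qed.

HB.instance Definition _ := Measure_isSigmaFinite.Build _ _ _ lebesgue_step
  lebesgue_step_sigma_finite.

End lebesgue_rV_step.

Lemma lebesgue_rV_sigma_finite_measure d :
  exists mu : {sigma_finite_measure set 'rV[R]_d -> \bar R},
    @lebesgue_rV d = mu.
Proof.
elim: d => [|d [mu IH]] /=; first by exists (dirac (0 : 'rV[R]_0)).
by rewrite IH; exists (lebesgue_step mu).
Qed.

Let lebesgue_rV0 d : @lebesgue_rV d set0 = 0%E.
Proof.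
by have [mu ->] := lebesgue_rV_sigma_finite_measure d; exact: measure0.
Qed.

Let lebesgue_rV_ge0 d A : (0 <= @lebesgue_rV d A)%E.
Proof.
by have [mu ->] := lebesgue_rV_sigma_finite_measure d; exact: measure_ge0.
Qed.

Let lebesgue_rV_semi_sigma_additive d : semi_sigma_additive (@lebesgue_rV d).
Proof.
have [mu ->] := lebesgue_rV_sigma_finite_measure d.
exact: measure_semi_sigma_additive.
Qed.

HB.instance Definition _ d := isMeasure.Build _ _ _ (@lebesgue_rV d)
  (lebesgue_rV0 d) (@lebesgue_rV_ge0 d) (@lebesgue_rV_semi_sigma_additive d).

Let lebesgue_rV_sigma_finite d : sigma_finite setT (@lebesgue_rV d).
Proof.
by have [mu ->] := lebesgue_rV_sigma_finite_measure d; exact: sigma_finiteT.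
Qed.

HB.instance Definition _ d :=
  Measure_isSigmaFinite.Build _ _ _ (@lebesgue_rV d)
    (@lebesgue_rV_sigma_finite d).

Lemma lebesgue_rV_box d (A : 'I_d -> set R) : (forall i, measurable (A i)) ->
  lebesgue_rV [set x : 'rV[R]_d | forall i, A i (x ord0 i)] =
  (\prod_(i < d) @lebesgue_measure R (A i))%E.
Proof.
elim: d A => [|d IH] A mA /=.
  by rewrite big_ord0 diracE mem_set//= => -[].
have [mu muE] := lebesgue_rV_sigma_finite_measure d.
rewrite big_ord_recl -IH// muE /pushforward.
rewrite -(@product_measure1E _ _ _ _ _ (@lebesgue_measure R)); last 2 first.
- exact: mA.
- rewrite [X in measurable X](_ : _ = \bigcap_(i : 'I_d)
    ((fun x : 'rV[R]_d => x ord0 i) @^-1` A (lift ord0 i))).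
    apply: fin_bigcap_measurable => // i _; rewrite -[X in measurable X]setTI.
    exact: measurable_coord_rV.
  by apply/seteqP; split => [x xA i _|x xA i] /=; [exact: xA|exact: (xA i I)].
have c0 (x : measurableTypeR R) (y : 'rV[R]_d) :
  cons_rV (x, y) ord0 ord0 = x by have := cons_rVK (x, y) => -[].
have cS (x : measurableTypeR R) (y : 'rV[R]_d) i :
  cons_rV (x, y) ord0 (lift ord0 i) = y ord0 i.
  by rewrite -rshift1 /cons_rV (row_mxEr (x : R)%:M y).
congr (_ _); apply/seteqP; split => [[x y] xyA|[x y] [/= Ax Ay] i] /=.
  split => [|i] /=; first by have := xyA ord0; rewrite c0.
  by have := xyA (lift ord0 i); rewrite cS.
by case: (unliftP ord0 i) => [j ->|->]; [rewrite cS|rewrite c0].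
Qed.

End borel_rV.

Section optimal_transport.
Context {R : realType} {d : nat}.
Implicit Types (rho mu nu : probability 'rV[R]_d R) (T S : 'rV[R]_d -> 'rV[R]_d).

(* The norm `|x| of the library on 'rV[R]_d is the max norm. *)
Definition enorm (x : 'rV[R]_d) : R := Num.sqrt (\sum_(i < d) x ord0 i ^+ 2).

(* When lebesgue_rV X is 0 or +oo, the right-hand side is 0 and no probability
   measure satisfies this. *)
Definition is_uniform_on (X : set 'rV[R]_d) rho :=
  forall A, measurable A ->
    rho A = ((fine (lebesgue_rV X))^-1%:E * lebesgue_rV (A `&` X))%E.

Definition is_coupling mu nu (g : probability ('rV[R]_d * 'rV[R]_d)%type R) :=
  (forall A, measurable A -> pushforward g fst A = mu A) /\
  (forall A, measurable A -> pushforward g snd A = nu A).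

Definition wasserstein (p : R) mu nu : \bar R :=
  (ereal_inf [set \int[g]_xy (enorm (xy.1 - xy.2) `^ p)%:E |
              g in is_coupling mu nu] `^ p^-1)%E.

Definition is_transport_map rho mu T :=
  measurable_fun setT T /\
  forall A, measurable A -> pushforward rho T A = mu A.

Definition transport_cost rho T : \bar R :=
  (\int[rho]_x (enorm (x - T x) ^+ 2)%:E)%E.

Definition is_optimal_map rho mu T :=
  is_transport_map rho mu T /\
  forall S, is_transport_map rho mu S ->
    (transport_cost rho T <= transport_cost rho S)%E.

Definition is_brenier_map rho mu T :=
  is_optimal_map rho mu T /\
  forall S, is_optimal_map rho mu S -> S = T %[ae rho].

Definition L2_dist rho T S : \bar R :=
  'N[rho]_2%:E [EFin \o (fun x => enorm (T x - S x))].

End optimal_transport.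

(* Main.v *)
(* Take X = (0,1)^d, Y = [0,1]^d and let e_0, e_1 be the first two basis vectors.
   For small h > 0 let A = {x in X | h x_0 + x_1 > 1}, of mass m <= h, and let
   S = {x in X | x_1 > 1 - m} be the strip of the same mass. Put
   mu = m delta_{e_1} + (1 - m) delta_0 and
   nu = m delta_{e_1 + h e_0} + (1 - m) delta_0.
   The Brenier maps send S to e_1, resp. A to e_1 + h e_0, and the rest to 0.
   Moving mass m by distance h gives W_p(mu, nu) <= h^(1 + 1/p), whereas
   tilting the interface by the slope h exchanges a set of mass at least h / 16
   between targets at distance at least 1, so that the L^2 distance is at least
   sqrt h / 4; the ratio of the two exponents of h is p / (2 (p + 1)). *)
Require Import Defs.
From HB Require Import structures.
From mathcomp Require Import all_boot all_order all_algebra.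
From mathcomp Require Import all_classical all_reals all_analysis.
From mathcomp Require Import measurable_realfun.
From mathcomp Require Import ring lra.
Import Order.TTheory GRing.Theory Num.Theory.
Import numFieldNormedType.Exports.
Local Open Scope classical_set_scope.
Local Open Scope ring_scope.

(** * Maps taking one value on a set and another off it *)

Section two_valued_maps.
Context {d1 d2 : measure_display} {T : measurableType d1} {U : measurableType d2}.
Context {R : realType}.
Implicit Types (A B : set T) (a b : U).

Definition two_valued A a b (x : T) : U := if x \in A then a else b.

Lemma two_valued_preimage A a b (E : set U) :
  two_valued A a b @^-1` E =
  (if a \in E then A else set0) `|` (if b \in E then ~` A else set0).
Proof.
apply/seteqP; split => x; rewrite /two_valued /=.
  have [xA /mem_set ->|xA /mem_set ->] := boolP (x \in A).
    by left; rewrite -in_setE.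
  by right; rewrite /= => /mem_set xA'; rewrite xA' in xA.
by case=> //; case: ifPn => // /set_mem ? xA; [rewrite mem_set|rewrite memNset].
Qed.

Lemma measurable_two_valued A a b : measurable A ->
  measurable_fun setT (two_valued A a b).
Proof.
move=> mA _ E mE; rewrite setTI two_valued_preimage.
by apply: measurableU; case: ifP => // _; apply: measurableC.
Qed.

(** The image measure depends on the set only through its mass. This lets the measure built from the
    strip be rewritten as an image over the tilted region. *)
Lemma pushforward_two_valued (P : probability T R) A B a b (E : set U) :
  measurable A -> measurable B -> P A = P B ->
  pushforward P (two_valued A a b) E = pushforward P (two_valued B a b) E.
Proof.
move=> mA mB PAB; rewrite /pushforward !two_valued_preimage.
case: ifP => _; case: ifP => _.
- by rewrite !setUv.
- by rewrite !setU0.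
- by rewrite !set0U !probability_setC// PAB.
- by [].
Qed.

End two_valued_maps.

(** * Euclidean inner product and norm, with their measurability *)

Section euclidean.
Context {R : realType} {d : nat}.
Implicit Types x y z : 'rV[R]_d.

Definition dotp x y : R := \sum_(i < d) x ord0 i * y ord0 i.

Lemma enorm_sqr x : enorm x ^+ 2 = \sum_(i < d) x ord0 i ^+ 2.
Proof. by rewrite /enorm sqr_sqrtr// sumr_ge0// => i _; rewrite sqr_ge0. Qed.

Lemma enorm_sqrB x y :
  enorm (x - y) ^+ 2 = enorm x ^+ 2 - 2 * dotp x y + enorm y ^+ 2.
Proof.
rewrite !enorm_sqr /dotp mulr_sumr -sumrN -!big_split/=.
by apply: eq_bigr => i _; rewrite !mxE; ring.
Qed.

Lemma measurable_enorm_sqr : measurable_fun setT (fun x => enorm x ^+ 2).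
Proof.
rewrite (_ : (fun _ => _) = fun x => \sum_(i < d) x ord0 i ^+ 2); last first.
  by apply/funext => x; rewrite enorm_sqr.
by apply: measurable_sum => i; apply: measurable_funX; exact: measurable_coord_rV.
Qed.

Lemma measurable_dotp y : measurable_fun setT (dotp^~ y).
Proof.
apply: measurable_sum => i; apply: measurable_funM => //.
exact: measurable_coord_rV.
Qed.

Lemma measurable_rVB d0 (T : measurableType d0) (f g : T -> 'rV[R]_d) :
  measurable_fun setT f -> measurable_fun setT g ->
  measurable_fun setT (fun t => f t - g t).
Proof.
move=> mf mg; apply: measurable_fun_rV => i.
rewrite [X in measurable_fun _ X](_ : _ =
    fun t => f t ord0 i - g t ord0 i); last first.
  by apply/funext => t; rewrite !mxE.
by apply: measurable_funB;
  apply: (measurableT_comp (measurable_coord_rV i)).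
Qed.

Lemma measurable_set1_rV y : measurable [set y].
Proof.
rewrite (_ : [set y] =
    \bigcap_(i : 'I_d) ((fun x : 'rV[R]_d => x ord0 i) @^-1` [set y ord0 i])).
  apply: fin_bigcap_measurable => // i _; rewrite -[X in measurable X]setTI.
  exact: measurable_coord_rV.
apply/seteqP; split => [x -> i _//|x xy] /=.
by apply/rowP => i; exact: (xy i I).
Qed.

End euclidean.

(** * Optimality and uniqueness of a map that is two-valued across a hyperplane *)

Section halfspace_map.
Context {R : realType} {d : nat}.
Variables (rho mu : probability 'rV[R]_d R) (y : 'rV[R]_d) (c : R).
Hypothesis y0 : y != 0.
Hypothesis yc : enorm y ^+ 2 <= 2 * c.
Let H := [set x : 'rV[R]_d | c < dotp x y].
Let T := two_valued H y (0 : 'rV[R]_d).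
Hypothesis muT : forall A, measurable A -> mu A = pushforward rho T A.
Hypothesis rho_moment : (\int[rho]_x (enorm x ^+ 2)%:E < +oo)%E.
Hypothesis rho_hyperplane : rho [set x | dotp x y = c] = 0.

(** The Lagrange multiplier for the mass sent to [y]: with it, [G x y - G x 0 = 2 * (c - dotp x y)],
    which changes sign exactly across the hyperplane bounding [H]. Hypothesis [yc] makes it
    nonnegative, so [G] is nonnegative too. *)
Let k := 2 * c - enorm y ^+ 2.

(* Each transport map pays the same total penalty k * mu {y}, and the penalized
   cost is minimized pointwise by T. *)
Let G (x z : 'rV[R]_d) : R := enorm (x - z) ^+ 2 + k * \1_[set y] z.

Let k0 : 0 <= k. Proof. by rewrite subr_ge0. Qed.

Let G0 x z : 0 <= G x z.
Proof. by rewrite addr_ge0 ?sqr_ge0// mulr_ge0. Qed.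

Let G_0 x : G x 0 = enorm x ^+ 2.
Proof.
rewrite /G subr0 indicE memNset ?mulr0 ?addr0//.
by move=> /= /esym/eqP; rewrite (negbTE y0).
Qed.

Let G_y x : G x y = enorm x ^+ 2 - 2 * (dotp x y - c).
Proof. by rewrite /G enorm_sqrB indicE mem_set//= /k; ring. Qed.

Let G_T x z : z = 0 \/ z = y -> G x (T x) <= G x z.
Proof.
rewrite /T /two_valued; case: ifPn => [/set_mem|] /=; last first.
  rewrite notin_setE /= => /negP; rewrite -leNgt => xc [] ->//.
  by rewrite G_0 G_y; lra.
by rewrite /H /= => xc [] ->//; rewrite G_0 G_y; lra.
Qed.

(** Off the hyperplane the values of [G x] at the two targets differ, so the minimizer is unique. *)
Let G_T_eq x z : dotp x y != c -> z = 0 \/ z = y -> G x (T x) = G x z -> z = T x.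
Proof.
rewrite /T /two_valued => /eqP xc'; case: ifPn => [/set_mem|] /=; last first.
  rewrite notin_setE /= => /negP; rewrite -leNgt => xc [] -> //.
  by rewrite G_0 G_y => GE; case: xc'; lra.
by rewrite /H /= => xc [] ->//; rewrite G_0 G_y => GE; case: xc'; lra.
Qed.

Let mH : measurable H.
Proof.
rewrite (_ : H = dotp^~ y @^-1` `]c, +oo[).
  by rewrite -[X in measurable X]setTI; exact: measurable_dotp.
by apply/seteqP; split => x /=; rewrite in_itv/= andbT.
Qed.

Let transport_T : is_transport_map rho mu T.
Proof.
by split => [|A mA]; [exact: measurable_two_valued|rewrite muT].
Qed.

Let measurable_cost (S : 'rV[R]_d -> 'rV[R]_d) : measurable_fun setT S ->
  measurable_fun setT (fun x : 'rV[R]_d => enorm (x - S x) ^+ 2).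
Proof.
move=> mS; apply: (measurableT_comp measurable_enorm_sqr).
exact: measurable_rVB.
Qed.

Let measurable_penalty (S : 'rV[R]_d -> 'rV[R]_d) : measurable_fun setT S ->
  measurable_fun setT (fun x : 'rV[R]_d => \1_[set y] (S x) : R).
Proof.
move=> mS; apply: (@measurableT_comp _ _ _ _ _ _ (\1_[set y] : _ -> R)) => //.
by apply: measurable_indic; exact: measurable_set1_rV.
Qed.

Let measurable_G (S : 'rV[R]_d -> 'rV[R]_d) : measurable_fun setT S ->
  measurable_fun setT (fun x : 'rV[R]_d => G x (S x)).
Proof.
move=> mS; apply: measurable_funD; first exact: measurable_cost.
by apply: measurable_funM => //; exact: measurable_penalty.
Qed.

(** The penalty integrates to [k] times the mass of the preimage of [y], and the transport condition
    fixes that mass. *)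
Let integral_G (S : 'rV[R]_d -> 'rV[R]_d) : is_transport_map rho mu S ->
  (\int[rho]_x (G x (S x))%:E = transport_cost rho S + k%:E * mu [set y])%E.
Proof.
move=> [mS muS]; under eq_integral do rewrite EFinD.
have mSy : measurable (S @^-1` [set y]).
  by rewrite -[X in measurable X]setTI; apply: mS => //; exact: measurable_set1_rV.
rewrite ge0_integralD//=.
- congr (_ + _)%E; under eq_integral do rewrite EFinM.
  rewrite ge0_integralZl_EFin//=.
  + rewrite -muS; last exact: measurable_set1_rV.
    by rewrite (integral_indic _ _ mSy)// setIT.
  + by apply/measurable_EFinP; exact: measurable_penalty.
- by move=> x _; rewrite lee_fin sqr_ge0.
- by apply/measurable_EFinP; exact: measurable_cost.
- by move=> x _; rewrite lee_fin mulr_ge0.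
- by apply/measurable_EFinP; apply: measurable_funM => //; exact: measurable_penalty.
Qed.

(** As an image under [T], [mu] does not charge the complement of the two targets, so neither does
    the image of [rho] under [S]. *)
Let transport_ae S : is_transport_map rho mu S ->
  {ae rho, forall x, S x = 0 \/ S x = y}.
Proof.
move=> [mS muS]; have mE : measurable (~` [set (0 : 'rV[R]_d); y]).
  by apply/measurableC/measurableU; exact: measurable_set1_rV.
exists (S @^-1` ~` [set 0; y]); split.
- by rewrite -[X in measurable X]setTI; exact: mS.
- have := muS _ mE; rewrite /pushforward => ->.
  rewrite muT// /pushforward two_valued_preimage !memNset ?setU0 ?measure0//=.
    by apply; left.
  by apply; right.
- by move=> x.
Qed.

Let ae_G_le S : is_transport_map rho mu S ->
  {ae rho, forall x, G x (T x) <= G x (S x)}.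
Proof. by move=> /transport_ae; apply: filterS => x; exact: G_T. Qed.

Let penalty_fin : (k%:E * mu [set y])%E \is a fin_num.
Proof. by apply: fin_numM => //; apply: fin_num_measure; exact: measurable_set1_rV. Qed.

Let measurable_GT : measurable_fun setT (fun x : 'rV[R]_d => G x (T x)).
Proof. by apply: measurable_G; case: transport_T. Qed.

(** Pointwise comparison with the target 0, where the penalized cost is the second moment
    integrand. *)
Let integral_G_lt : (\int[rho]_x (G x (T x))%:E < +oo)%E.
Proof.
apply: le_lt_trans rho_moment; apply: ge0_le_integral => //.
- by move=> x _; rewrite lee_fin.
- by apply/measurable_EFinP; exact: measurable_GT.
- by apply/measurable_EFinP; exact: measurable_enorm_sqr.
- by move=> x _; rewrite lee_fin -G_0; apply: G_T; left.
Qed.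

(** Adding the same finite penalty to both costs reduces the claim to the pointwise minimality of
    [T]. *)
Let transport_cost_T_le S : is_transport_map rho mu S ->
  (transport_cost rho T <= transport_cost rho S)%E.
Proof.
move=> tS; rewrite -(leeD2rE _ _ penalty_fin) -!integral_G//.
apply: ae_ge0_le_integral => //.
- by move=> x _; rewrite lee_fin.
- by apply/measurable_EFinP; exact: measurable_GT.
- by move=> x _; rewrite lee_fin.
- by apply/measurable_EFinP; apply: measurable_G; case: tS.
- by have := ae_G_le _ tS; apply: filterS => x GTS _; rewrite lee_fin.
Qed.

(** For uniqueness, an optimal [S] has the same penalized integral as [T]. The a.e. nonnegative
    difference of the integrands then vanishes a.e., and off the null hyperplane this forces
    [S x = T x]. *)
Lemma halfspace_brenier_map : is_brenier_map rho mu T.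
Proof.
split=> [|S [tS optS]]; first by split=> // S; exact: transport_cost_T_le.
have mGS : measurable_fun setT (fun x : 'rV[R]_d => G x (S x)).
  by apply: measurable_G; case: tS.
have mabsD : measurable_fun setT (fun x : 'rV[R]_d => `|G x (S x) - G x (T x)|).
  by apply: measurableT_comp => //; exact: measurable_funB.
have mD : measurable_fun setT (fun x : 'rV[R]_d => (G x (S x) - G x (T x))%:E).
  by apply/measurable_EFinP; exact: measurable_funB.
have GST : (\int[rho]_x (G x (S x))%:E = \int[rho]_x (G x (T x))%:E)%E.
  rewrite !integral_G//; congr (_ + _)%E; apply/eqP.
  by rewrite eq_le optS//= transport_cost_T_le.
have D0 : (\int[rho]_x `|(G x (S x) - G x (T x))%:E| = 0)%E.
  have GTfin : (\int[rho]_x (G x (T x))%:E)%E \is a fin_num.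
    by rewrite ge0_fin_numE ?integral_G_lt// integral_ge0// => x _; rewrite lee_fin.
  (* Additivity is applied to nonnegative integrands only; the finite term [GTfin] is cancelled
     afterwards. *)
  have : (\int[rho]_x (G x (T x))%:E + \int[rho]_x `|(G x (S x) - G x (T x))%:E| =
          \int[rho]_x (G x (T x))%:E)%E.
    rewrite -[RHS]GST -ge0_integralD//=; last 3 first.
    - by move=> x _; rewrite lee_fin.
    - exact/measurable_EFinP.
    - exact/measurable_EFinP.
    apply: ge0_ae_eq_integral => //=.
    - apply: emeasurable_funD; first exact/measurable_EFinP.
      exact/measurable_EFinP.
    - exact/measurable_EFinP.
    - by move=> x _; rewrite adde_ge0// lee_fin.
    - by move=> x _; rewrite lee_fin.
    have := ae_G_le _ tS; apply: filterS => x GTS _.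
    by rewrite -EFinD ger0_norm ?subr_ge0// addrC subrK.
  rewrite -(fineK GTfin); case: (\int[rho]_x `|_|)%E => [r| |] // [r0].
  by congr (_%:E); lra.
have /(ae_eq_integral_abs _ measurableT mD) D0' := D0.
have yH : {ae rho, forall x, dotp x y != c}.
  exists [set x | dotp x y = c]; split => //.
    rewrite -[X in measurable X]setTI.
    exact: (measurable_dotp y _ [set c]).
  by move=> x /= /negP; rewrite negbK => /eqP.
have S0y := transport_ae _ tS.
near=> x => _.
have xD : (G x (S x) - G x (T x))%:E = 0%E by near: x; apply: filterS D0' => x /(_ I).
apply: G_T_eq; [by near: x|by near: x|].
by apply/esym/eqP; rewrite -subr_eq0; case: xD => ->.
Unshelve. all: by end_near.
Qed.

End halfspace_map.

(** * Upper bound on the Wasserstein distance and lower bound on the L2 distance *)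

Section transport_estimates.
Context {R : realType} {d : nat}.

Lemma measurable_enorm : measurable_fun setT (@enorm R d).
Proof.
rewrite (_ : @enorm R d = fun x => (enorm x ^+ 2) `^ 2^-1); last first.
  apply/funext => x; rewrite powR12_sqrt ?sqr_ge0// sqrtr_sqr ger0_norm//.
  exact: sqrtr_ge0.
by apply: (measurableT_comp (measurable_powR 2^-1)); exact: measurable_enorm_sqr.
Qed.

Lemma enorm0 : enorm (0 : 'rV[R]_d) = 0.
Proof.
by rewrite /enorm big1 ?sqrtr0// => i _; rewrite mxE expr0n.
Qed.

Lemma enormN (x : 'rV[R]_d) : enorm (- x) = enorm x.
Proof.
by congr (Num.sqrt _); apply: eq_bigr => i _; rewrite mxE sqrrN.
Qed.

(** The image of [rho] under the map equal to [(a, b)] on [A] and [(c, c)] elsewhere is a coupling;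
    only [A] contributes to its cost. *)
Lemma wasserstein_two_valued_le (rho mu nu : probability 'rV[R]_d R) A
    (a b c : 'rV[R]_d) (p : R) : 0 < p -> measurable A ->
  (forall E, measurable E -> mu E = pushforward rho (two_valued A a c) E) ->
  (forall E, measurable E -> nu E = pushforward rho (two_valued A b c) E) ->
  (wasserstein p mu nu <= ((enorm (a - b) `^ p)%:E * rho A) `^ p^-1)%E.
Proof.
move=> p0 mA muE nuE.
have mf := measurable_two_valued A (a, b) (c, c) mA.
pose g := distribution rho (mfun_Sub (mem_set mf)).
have fstE : fst \o two_valued A (a, b) (c, c) = two_valued A a c.
  by apply/funext => x; rewrite /= /two_valued; case: ifP.
have sndE : snd \o two_valued A (a, b) (c, c) = two_valued A b c.
  by apply/funext => x; rewrite /= /two_valued; case: ifP.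
have gP : is_coupling mu nu g.
  by split=> E mE; [rewrite muE// -fstE|rewrite nuE// -sndE].
have gcost : (\int[g]_xy (enorm (xy.1 - xy.2) `^ p)%:E =
    (enorm (a - b) `^ p)%:E * rho A)%E.
  rewrite ge0_integral_distribution/=; last 2 first.
  - apply/measurable_EFinP; apply: (measurableT_comp (measurable_powR p)).
    apply: (measurableT_comp measurable_enorm).
    by apply: measurable_rVB.
  - by move=> xy; rewrite lee_fin powR_ge0.
  transitivity (\int[rho]_x ((enorm (a - b) `^ p)%:E * (\1_A x)%:E))%E.
    apply: eq_integral => x _ /=; rewrite /two_valued indicE.
    by case: ifP => _ /=; rewrite ?mule1// subrr enorm0 powR0 ?gt_eqF// mule0.
  rewrite ge0_integralZl_EFin ?powR_ge0//; last exact/measurable_EFinP/measurable_indic.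
  by rewrite integral_indic// setIT.
rewrite -gcost; apply: gt0_ler_poweR.
- by rewrite invr_ge0 ltW.
- rewrite in_itv/= leey andbT; apply: le_ereal_inf_tmp => _ [h _ <-].
  by apply: integral_ge0 => x _; rewrite lee_fin powR_ge0.
- rewrite in_itv/= leey andbT.
  by apply: integral_ge0 => x _; rewrite lee_fin powR_ge0.
- by apply: ereal_inf_lbound; exists g.
Qed.

(** Chebyshev's argument: the squared distance dominates the indicator of [B]. *)
Lemma L2_dist_ge (rho : probability 'rV[R]_d R) (T S : 'rV[R]_d -> 'rV[R]_d) B :
  measurable_fun setT T -> measurable_fun setT S -> measurable B ->
  (forall x, B x -> 1 <= enorm (T x - S x)) ->
  (rho B `^ 2^-1 <= L2_dist rho T S)%E.
Proof.
move=> mT mS mB BTS; rewrite /L2_dist unlock /=.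
apply: gt0_ler_poweR; rewrite ?in_itv/= ?leey ?andbT//.
  by apply: integral_ge0 => x _; rewrite lee_fin powR_ge0.
rewrite -[in leLHS](setIT B) -integral_indic//; apply: ge0_le_integral => //=.
- by apply/measurable_EFinP/measurable_indic.
- apply/measurable_EFinP; apply: (measurableT_comp (measurable_powR 2)).
  apply: measurableT_comp => //; apply: (measurableT_comp measurable_enorm).
  exact: measurable_rVB.
- move=> x _; rewrite lee_fin indicE; case: (boolP (x \in B)) => [/set_mem Bx|_].
    apply: (@le_trans _ _ (1 `^ 2)); [by rewrite powR1|apply: ge0_ler_powR; rewrite ?nnegrE//].
    exact: le_trans (BTS _ Bx) (ler_norm _).
  exact: powR_ge0.
Qed.

End transport_estimates.

(** * The unit cube and its uniform measure *)

Section unit_cube.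
Context {R : realType}.

Definition cube d : set 'rV[R]_d := [set x | forall i, `]0, 1[%classic (x ord0 i)].

Lemma measurable_box d (A : 'I_d -> set R) : (forall i, measurable (A i)) ->
  measurable [set x : 'rV[R]_d | forall i, A i (x ord0 i)].
Proof.
move=> mA; rewrite (_ : mkset _ =
    \bigcap_(i : 'I_d) ((fun x : 'rV[R]_d => x ord0 i) @^-1` A i)).
  apply: fin_bigcap_measurable => // i _; rewrite -[X in measurable X]setTI.
  exact: measurable_coord_rV.
by apply/seteqP; split => [x xA i _|x xA i] /=; [exact: xA|exact: (xA i I)].
Qed.

Lemma measurable_cube d : measurable (@cube d).
Proof. by apply: (@measurable_box d (fun=> `]0, 1[%classic)). Qed.

Lemma lebesgue_measure_itv_oo (a b : R) : a <= b ->
  lebesgue_measure `]a, b[%classic = (b - a)%:E.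
Proof.
rewrite le_eqVlt => /predU1P[->|ab]; rewrite lebesgue_measure_itv/= lte_fin.
  by rewrite ltxx subrr.
by rewrite ab.
Qed.

Lemma lebesgue_cube d : lebesgue_rV (@cube d) = 1%E.
Proof.
rewrite (@lebesgue_rV_box _ d (fun=> `]0, 1[%classic))// big1// => i _.
by rewrite lebesgue_measure_itv_oo// subr0.
Qed.

(** Balls of row vectors are taken entrywise, hence are cubes; openness of the cube follows. *)
Lemma cube_ball d : (0 < d)%N -> @cube d = ball (const_mx 2^-1 : 'rV[R]_d) 2^-1.
Proof.
move=> d0; apply/seteqP; split => [x xc|x xb i].
  split=> [|i j]; first by rewrite invr_gt0.
  have := xc j; rewrite /= in_itv/= (ord1 i) mxE /ball/= => /andP[x0 x1].
  by rewrite ltr_distlC; apply/andP; split; lra.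
have := xb.2 ord0 i; rewrite /= in_itv/= mxE /ball/= ltr_distlC => /andP[x0 x1].
by apply/andP; split; lra.
Qed.

Lemma open_cube d : (0 < d)%N -> open (@cube d).
Proof. by move=> d0; rewrite cube_ball//; apply: ball_open; rewrite invr_gt0. Qed.

Lemma compact_closed_cube d :
  compact [set x : 'rV[R]_d | forall i, `[0, 1]%classic (x ord0 i)].
Proof. by apply: (@rV_compact R d (fun=> _)) => i; exact: segment_compact. Qed.

Lemma bounded_cube d : bounded_set (@cube d).
Proof.
apply: sub_boundedr (compact_bounded (@compact_closed_cube d)).
by move=> B cB x xc; apply: cB => i; apply: subset_itv_oo_cc; exact: xc.
Qed.

(** The cube has Lebesgue measure 1, so the restriction is already normalized. *)
Lemma exists_uniform_cube d : exists rho : probability 'rV[R]_d R,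
  forall A, rho A = lebesgue_rV (A `&` @cube d).
Proof.
pose m := mrestr (@lebesgue_rV R d) (@measurable_cube d).
have m1 : m setT = 1%E by rewrite /m /mrestr setTI lebesgue_cube.
pose P := HB.pack_for (probability 'rV[R]_d R) m
  (Measure_isProbability.Build _ _ _ m m1).
by exists P.
Qed.

End unit_cube.

(** * Tilted vectors and the half-spaces they define *)

Section tilted_halfspace.
Context {R : realType} {n : nat}.
Implicit Types (x : 'rV[R]_n.+2) (h c : R).

Let i1 : 'I_n.+2 := lift ord0 ord0.

(** This is e_1 + h e_0: indices beyond the list read the default 0. *)
Definition tilt h : 'rV[R]_n.+2 := \row_i [:: h; 1]`_i.

Lemma dotp_tilt x h : dotp x (tilt h) = h * x ord0 ord0 + x ord0 i1.
Proof.
rewrite /dotp !big_ord_recl big1 => [|i _]; first by rewrite !mxE/=; ring.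
by rewrite !mxE !lift0/= nth_nil mulr0.
Qed.

Lemma enorm_sqr_tilt h : enorm (tilt h) ^+ 2 = h ^+ 2 + 1.
Proof.
rewrite enorm_sqr !big_ord_recl big1 => [|i _]; first by rewrite !mxE/=; ring.
by rewrite !mxE !lift0/= nth_nil expr0n.
Qed.

Lemma enorm_tilt_ge1 h : 1 <= enorm (tilt h).
Proof.
rewrite -(@ler_pXn2r _ 2) ?nnegrE ?sqrtr_ge0//.
by rewrite enorm_sqr_tilt expr1n lerDr sqr_ge0.
Qed.

Lemma tilt_neq0 h : tilt h != 0.
Proof.
apply/eqP => t0; have := enorm_tilt_ge1 h.
by rewrite t0 enorm0 ler10.
Qed.

Lemma enorm_tiltB h h' : enorm (tilt h - tilt h') = `|h - h'|.
Proof.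
rewrite /enorm !big_ord_recl big1 => [|i _].
  by rewrite !mxE/= subrr expr0n !addr0 sqrtr_sqr.
by rewrite !mxE !lift0/= nth_nil subrr expr0n.
Qed.

Lemma measurable_halfspace h c : measurable [set x | c < dotp x (tilt h)].
Proof.
rewrite (_ : mkset _ = (@dotp R n.+2)^~ (tilt h) @^-1` `]c, +oo[).
  by rewrite -[X in measurable X]setTI; exact: measurable_dotp.
by apply/seteqP; split => x /=; rewrite in_itv/= andbT.
Qed.

(* Fubini along the first coordinate: each section of the hyperplane is a box
   with one degenerate side. *)
Lemma lebesgue_hyperplane h c : lebesgue_rV [set x | dotp x (tilt h) = c] = 0%E.
Proof.
have [mu muE] := @lebesgue_rV_sigma_finite_measure R n.+1.
rewrite -[LHS]/((lebesgue_measure \x @lebesgue_rV R n.+1)%E _).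
rewrite muE; apply: integral0_eq => t _ /=; rewrite -muE.
pose S (i : 'I_n.+1) := if i == ord0 then [set c - h * t] else setT.
rewrite (_ : xsection _ _ = [set z : 'rV[R]_n.+1 | forall i, S i (z ord0 i)]).
  rewrite (@lebesgue_rV_box R _ S) => [|i]; last by rewrite /S; case: ifP.
  by rewrite big_ord_recl/= lebesgue_measure_set1 mul0e.
have c0 z : cons_rV (t, z) ord0 ord0 = t :> R.
  by have := cons_rVK (t, z) => -[].
have cS z : cons_rV (t, z) ord0 i1 = z ord0 ord0 :> R.
  by rewrite /i1 -rshift1 /cons_rV (row_mxEr (t : R)%:M z).
apply/seteqP; split => z; rewrite /xsection /= inE /= dotp_tilt c0 cS.
  by move=> zc i; rewrite /S; case: eqP => // ->; rewrite -zc addrAC subrr add0r.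
by move=> /(_ ord0)/= ->; rewrite addrC subrK.
Qed.

End tilted_halfspace.

(** * Masses of slabs and boxes in the cube, and the unstable pair of measures *)

Section uniform_on_cube.
Context {R : realType} {n : nat}.
Variable rho : probability 'rV[R]_n.+2 R.
Hypothesis rhoE : forall A, rho A = lebesgue_rV (A `&` @cube R n.+2).
Implicit Types (a b c e h m : R).

Let i1 : 'I_n.+2 := lift ord0 ord0.

Let box (a b c e : R) : set 'rV[R]_n.+2 :=
  [set x | `]a, b[%classic (x ord0 ord0) /\ `]c, e[%classic (x ord0 i1)].

Let measurable_box2 a b c e : measurable (box a b c e).
Proof.
apply: measurableI; rewrite -[X in measurable X]setTI.
  exact: (@measurable_coord_rV R n.+2 ord0 measurableT `]a, b[%classic).
exact: (@measurable_coord_rV R n.+2 i1 measurableT `]c, e[%classic).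
Qed.

Let rho_box a b c e : 0 <= a -> a <= b -> b <= 1 -> 0 <= c -> c <= e -> e <= 1 ->
  rho (box a b c e) = ((b - a) * (e - c))%:E.
Proof.
move=> a0 ab b1 c0 ce e1; rewrite rhoE.
pose A (i : 'I_n.+2) : set R := if i == ord0 then `]a, b[%classic
  else if i == i1 then `]c, e[%classic else `]0, 1[%classic.
rewrite (_ : _ `&` _ = [set x : 'rV[R]_n.+2 | forall i, A i (x ord0 i)]).
  rewrite (@lebesgue_rV_box R _ A) => [|i]; last first.
    by rewrite /A; case: ifP => // _; case: ifP.
  rewrite !big_ord_recl big1 => [|i _]; last first.
    by rewrite /A/= lebesgue_measure_itv_oo// subr0.
  by rewrite /A/= !lebesgue_measure_itv_oo// mule1 EFinM.
apply/seteqP; split => x /=.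
  move=> [[x0 x1] xc] i; rewrite /A; case: eqP => [->//|_].
  by case: eqP => [->//|_]; exact: xc.
move=> xA; have x0 := xA ord0; have x1 := xA i1; split; first by [].
move=> i; have := xA i; rewrite /A; case: ifP => _.
  by rewrite /= !in_itv/= => /andP[? ?]; apply/andP; split; lra.
case: ifP => // _.
by rewrite /= !in_itv/= => /andP[? ?]; apply/andP; split; lra.
Qed.

Let rho_cube : rho (@cube R n.+2) = 1%E.
Proof. by rewrite rhoE setIid lebesgue_cube. Qed.

Let ae_cube : {ae rho, forall x, @cube R n.+2 x}.
Proof.
exists (~` @cube R n.+2); split.
- by apply: measurableC; exact: measurable_cube.
- by rewrite probability_setC ?rho_cube ?subee//; exact: measurable_cube.
- by move=> x.
Qed.

(** On the cube each squared coordinate is at most 1, so the integrand is a.e. bounded by the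
    dimension. *)
Let rho_moment : (\int[rho]_x (enorm x ^+ 2)%:E < +oo)%E.
Proof.
apply: (@le_lt_trans _ _ (\int[rho]_x (cst n.+2%:R%:E x))%E); last first.
  by rewrite integral_cst// [X in (_ * X)%E](probability_setT rho) mule1 ltry.
apply: ae_ge0_le_integral => //.
- by move=> x _; rewrite lee_fin sqr_ge0.
- by apply/measurable_EFinP; exact: measurable_enorm_sqr.
- by move=> x _; rewrite lee_fin.
- apply: filterS ae_cube => x xc _; rewrite lee_fin enorm_sqr.
  rewrite -[leRHS]mulr1 -[in leRHS](card_ord n.+2) -sumr_const mulr_suml.
  apply: ler_sum => i _; have := xc i; rewrite /= in_itv/= => /andP[x0 x1].
  by rewrite mul1r expr_le1// ltW.
Qed.

Let rho_hyperplane h c : rho [set x | dotp x (tilt h) = c] = 0%E.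
Proof.
rewrite rhoE; apply/eqP; rewrite -measure_le0 -[leRHS](@lebesgue_hyperplane R n h c).
apply: le_measure; rewrite ?inE; last exact: subIsetl.
  apply: measurableI; last exact: measurable_cube.
  by rewrite -[X in measurable X]setTI; exact: (measurable_dotp _ measurableT [set c]).
by rewrite -[X in measurable X]setTI; exact: (measurable_dotp _ measurableT [set c]).
Qed.

(** Within the cube, [H h 1] is the tilted region and [H 0 (1 - m)] the horizontal strip. *)
Let H h c : set 'rV[R]_n.+2 := [set x | c < dotp x (tilt h)].

Let tilt_brenier_map (mu : probability 'rV[R]_n.+2 R) h c : h ^+ 2 + 1 <= 2 * c ->
  (forall A, measurable A ->
    mu A = pushforward rho (two_valued (H h c) (tilt h) 0) A) ->
  is_brenier_map rho mu (two_valued (H h c) (tilt h) 0).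
Proof.
move=> hc muE; apply: halfspace_brenier_map => //.
- exact: tilt_neq0.
- by rewrite enorm_sqr_tilt.
Qed.

Let rho_le A B : measurable A -> measurable B -> A `&` @cube R n.+2 `<=` B ->
  (rho A <= rho B)%E.
Proof.
move=> mA mB AB; rewrite !rhoE; apply: le_measure; rewrite ?inE.
- by apply: measurableI => //; exact: measurable_cube.
- by apply: measurableI => //; exact: measurable_cube.
- by move=> x [Ax xc]; split=> //; apply: AB.
Qed.

(** Since x_0 < 1 on the cube, h x_0 + x_1 > 1 forces x_1 > 1 - h. *)
Let rho_tilted_le h : 0 <= h -> h <= 1 -> (rho (H h 1) <= h%:E)%E.
Proof.
move=> h0 h1; apply: (@le_trans _ _ (rho (box 0 1 (1 - h) 1))).
  apply: rho_le => //; first exact: measurable_halfspace.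
  move=> x [+ xc]; have := xc ord0; have := xc i1.
  rewrite /H /box /= !in_itv/= dotp_tilt -/i1 => /andP[x10 x11] /andP[x00 x01] xh.
  by split; apply/andP; split => //; nra.
rewrite rho_box ?lee_fin//; lra.
Qed.

Let rho_strip m : 0 <= m -> m <= 1 -> rho (H 0 (1 - m)) = m%:E.
Proof.
move=> m0 m1; transitivity (rho (box 0 1 (1 - m) 1)); last first.
  by rewrite rho_box//; [congr (_%:E); ring|lra|lra].
apply/eqP; rewrite eq_le; apply/andP; split; apply: rho_le => //.
- exact: measurable_halfspace.
- move=> x [+ xc]; have := xc ord0; have := xc i1.
  rewrite /H /box /= !in_itv/= dotp_tilt -/i1 mul0r add0r.
  by move=> /andP[x10 x11] /andP[x00 x01] ->; rewrite x00 x01 x11.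
- exact: measurable_halfspace.
- move=> x [+ _]; rewrite /H /box /= !in_itv/= dotp_tilt -/i1 mul0r add0r.
  by move=> [_ /andP[]].
Qed.

(* If m <= h / 2, the tilted region sticks out of the strip near x_0 = 1;
   otherwise the strip sticks out of the tilted region near x_0 = 0. *)
Let box_between h m : 0 < h -> h <= 2^-1 -> 0 <= m -> m <= h ->
  exists B, [/\ measurable B, rho B = (h / 16)%:E &
    (B `<=` H h 1 `\` H 0 (1 - m)) \/ (B `<=` H 0 (1 - m) `\` H h 1)].
Proof.
move=> h0 h1 m0 mh; have [mh2|mh2] := leP m (h / 2).
  (* Here h x_0 + x_1 > 3h/4 + 1 - 3h/4 = 1, while x_1 < 1 - h/2 <= 1 - m; the area is
     (1/4)(h/4). *)
  exists (box (3 / 4) 1 (1 - 3 * h / 4) (1 - h / 2)); split => //.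
    by rewrite rho_box; [congr (_%:E); field|lra..].
  left => x; rewrite /H /box /= !in_itv/= !dotp_tilt -/i1.
  move=> [/andP[x00 x01] /andP[x10 x11]]; split; first nra.
  by apply/negP; rewrite -leNgt; lra.
(* Here x_1 > 1 - h/2 > 1 - m, while h x_0 + x_1 < h/4 + 1 - h/4 = 1; the area is again h/16. *)
exists (box 0 (1 / 4) (1 - h / 2) (1 - h / 4)); split => //.
  by rewrite rho_box; [congr (_%:E); field|lra..].
right => x; rewrite /H /box /= !in_itv/= !dotp_tilt -/i1.
move=> [/andP[x00 x01] /andP[x10 x11]]; split; first lra.
by apply/negP; rewrite -leNgt; nra.
Qed.

(** One pair, depending only on [h], serves all exponents [p] at once. *)
Lemma unstable_pair h : 0 < h -> h <= 2^-1 ->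
  let Y := [set x : 'rV[R]_n.+2 | forall i, `[0, 1]%classic (x ord0 i)] in
  exists mu nu : probability 'rV[R]_n.+2 R,
    [/\ mu Y = 1%E, nu Y = 1%E &
      exists Tmu Tnu : 'rV[R]_n.+2 -> 'rV[R]_n.+2,
      [/\ is_brenier_map rho mu Tmu, is_brenier_map rho nu Tnu,
        forall p, 1 <= p -> (wasserstein p mu nu <= (h `^ (1 + p^-1))%:E)%E &
        ((Num.sqrt h / 4)%:E <= L2_dist rho Tmu Tnu)%E]].
Proof.
move=> h0 h2 Y; pose A := H h 1; pose m := fine (rho A).
have mA : measurable A by exact: measurable_halfspace.
have rA : rho A = m%:E by rewrite fineK// fin_num_measure.
have m0 : 0 <= m by rewrite fine_ge0.
have mh : m <= h by rewrite -lee_fin -rA; apply: rho_tilted_le; lra.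
(* The height of the strip is the mass of [A], so both measures put the same mass on their nonzero
   target. *)
pose S := H 0 (1 - m).
have mS : measurable S by exact: measurable_halfspace.
have rS : rho S = rho A by rewrite rA; apply: rho_strip; lra.
have mTmu : measurable_fun setT (two_valued S (tilt 0) (0 : 'rV[R]_n.+2)).
  exact: measurable_two_valued.
have mTnu : measurable_fun setT (two_valued A (tilt h) (0 : 'rV[R]_n.+2)).
  exact: measurable_two_valued.
pose mu := distribution rho (mfun_Sub (mem_set mTmu)).
pose nu := distribution rho (mfun_Sub (mem_set mTnu)).
have Y0 : Y 0 by move=> i; rewrite /= mxE in_itv/= lexx ler01.
have Yt k : 0 <= k <= 1 -> Y (tilt k).
  move=> k01 i; rewrite /= mxE in_itv/=.
  by case: i => -[|[|i]] ilt //=; rewrite ?nth_nil ?ler01 ?lexx.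
have YT (B : set 'rV[R]_n.+2) k : 0 <= k <= 1 ->
    rho (two_valued B (tilt k) (0 : 'rV[R]_n.+2) @^-1` Y) = 1%E.
  move=> k01; rewrite two_valued_preimage !mem_set//; last exact: Yt.
  by rewrite setUv probability_setT.
exists mu, nu; split.
- by apply: YT; rewrite lexx ler01.
- by apply: YT; lra.
exists (two_valued S (tilt 0) 0), (two_valued A (tilt h) 0); split.
(* The nonnegativity condition on the multiplier reads 1 <= 2 (1 - m), which holds as m <= h <=
   1/2. *)
- by apply: tilt_brenier_map => //; rewrite expr0n add0r; lra.
- by apply: tilt_brenier_map => //; nra.
- move=> p p1; apply: le_trans.
    apply: (@wasserstein_two_valued_le _ _ rho mu nu A (tilt 0) (tilt h) 0) => //.
      lra.
    (* Since [S] and [A] have equal mass, [mu] is also an image over [A], which gives the coupling a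
       common source set. *)
    by move=> E mE; apply: pushforward_two_valued.
  rewrite enorm_tiltB sub0r normrN gtr0_norm// rA -EFinM poweR_EFin lee_fin.
  (* The bound is (h^p m)^(1/p) = h m^(1/p) <= h h^(1/p), by m <= h. *)
  rewrite powRD; last by rewrite gt_eqF// addr_gt0// invr_gt0; lra.
  rewrite powRM ?powR_ge0// -powRrM mulfV ?gt_eqF; [|lra..].
  rewrite ler_wpM2l ?powR_ge0//.
  by apply: ge0_ler_powR; rewrite ?nnegrE ?invr_ge0//; lra.
have [B [mB rB AB]] := box_between _ _ h0 h2 m0 mh.
apply: le_trans (@L2_dist_ge _ _ rho _ _ B mTmu mTnu mB _).
  rewrite rB poweR_EFin powR12_sqrt; last by rewrite divr_ge0// ltW.
  rewrite lee_fin sqrtrM; last exact: ltW.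
  rewrite (_ : Num.sqrt 16^-1 = 4^-1)//.
  have -> : 16^-1 = 4^-1 ^+ 2 :> R by field.
  by rewrite sqrtr_sqr ger0_norm.
(* On [B] exactly one of the two maps vanishes; the other takes a tilted value, of norm at least
   1. *)
move=> x Bx; rewrite /two_valued; case: AB => /(_ _ Bx)[Hx nHx].
  by rewrite (memNset nHx) (mem_set Hx) sub0r enormN; exact: enorm_tilt_ge1.
rewrite (memNset nHx) (mem_set Hx) subr0; exact: enorm_tilt_ge1.
Qed.

End uniform_on_cube.

(** * Choice of the scale and conclusion *)

Lemma small_scale (R : realType) (C s : R) : 0 < C -> 0 < s ->
  exists h : R, [/\ 0 < h, h <= 2^-1 & C * h `^ s < 4^-1].
Proof.
(* This solves C h^s = 1/8, strictly below the required 1/4; capping it at 1/2 only decreases the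
   power. *)
move=> C0 s0; pose h1 := (8 * C)^-1 `^ s^-1.
have h1s : h1 `^ s = (8 * C)^-1.
  by rewrite -powRrM mulVf ?gt_eqF// powRr1// invr_ge0 mulr_ge0// ltW.
have h10 : 0 < h1 by rewrite powR_gt0// invr_gt0 mulr_gt0.
exists (Num.min h1 2^-1); split.
- by rewrite lt_min h10 invr_gt0 ltr0n.
- by rewrite ge_min lexx orbT.
apply: (@le_lt_trans _ _ (C * h1 `^ s)).
  rewrite ler_pM2l//; apply: ge0_ler_powR.
  - exact: ltW.
  - by rewrite nnegrE le_min (ltW h10) invr_ge0 ler0n.
  - by rewrite nnegrE ltW.
  - by rewrite ge_min lexx.
rewrite h1s (_ : _ * _ = 8^-1); first by rewrite ltf_pV2 ?posrE// ltr_nat.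
by field; rewrite gt_eqF.
Qed.

Theorem theorem1p2 (R : realType) (d : nat) (hd : (2 <= d)%N) :
  exists (X Y : set 'rV[R]_d) (rho : probability 'rV[R]_d R),
    [/\ open X, bounded_set X, compact Y, is_uniform_on X rho &
      forall C p alpha : R, 0 < C -> 1 <= p -> p / (2 * (p + 1)) < alpha ->
      exists mu nu : probability 'rV[R]_d R,
        [/\ mu Y = 1%E, nu Y = 1%E &
          exists Tmu Tnu : 'rV[R]_d -> 'rV[R]_d,
            [/\ is_brenier_map rho mu Tmu, is_brenier_map rho nu Tnu &
              (C%:E * wasserstein p mu nu `^ alpha < L2_dist rho Tmu Tnu)%E]]].
Proof.
case: d hd => [//|[//|n]] _.
have [rho rhoE] := @exists_uniform_cube R n.+2.
exists (@cube R n.+2), [set x : 'rV[R]_n.+2 | forall i, `[0, 1]%classic (x ord0 i)], rho.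
split.
- exact: open_cube.
- exact: bounded_cube.
- exact: compact_closed_cube.
- by move=> A mA; rewrite lebesgue_cube/= invr1 mul1e.
move=> C p alpha C0 p1 pa.
have p0 : 0 < p by lra.
have alpha0 : 0 < alpha.
  by apply: le_lt_trans pa; rewrite divr_ge0// ?mulr_ge0//; lra.
(* The gap between the exponent of h in the bound on W_p^alpha and the exponent 1/2 of the L2 bound;
   it is positive exactly when alpha > p / (2 (p + 1)). *)
pose s := (1 + p^-1) * alpha - 2^-1.
have s0 : 0 < s.
  have -> : s = (p + 1) / p * (alpha - p / (2 * (p + 1))).
    by rewrite /s; field; apply/andP; split; rewrite gt_eqF//; lra.
  by rewrite mulr_gt0 ?subr_gt0// divr_gt0//; lra.
have [h [h0 h2 Chs]] := @small_scale R C s C0 s0.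
have [mu [nu [muY nuY [Tmu [Tnu [bmu bnu W L2]]]]]] := unstable_pair rho rhoE h h0 h2.
exists mu, nu; split => //; exists Tmu, Tnu; split => //.
apply: lt_le_trans L2; apply: (@le_lt_trans _ _ (C * h `^ ((1 + p^-1) * alpha))%:E).
  rewrite EFinM lee_pmul2l// powRrM -poweR_EFin.
  apply: gt0_ler_poweR; rewrite ?(ltW alpha0)// ?in_itv/= ?leey ?andbT ?lee_fin ?powR_ge0//.
    exact: poweR_ge0.
  exact: W.
(* Factoring out sqrt h leaves C h^s < 1/4, which is how [h] was chosen. *)
rewrite lte_fin (_ : (1 + p^-1) * alpha = s + 2^-1); last by rewrite /s subrK.
rewrite powRD; last by rewrite (gt_eqF h0) implybT.
rewrite powR12_sqrt ?(ltW h0)// mulrA mulrC ltr_pM2l// sqrtr_gt0//.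
Qed.
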